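(* Let $\mathbf d=(\mathbf a,\mathbf b,\mathbf c)\in\Pi_{p,q,r}$ be a triple of compositions obtained by permutations of the parts (within each of the three compositions) from one of the triples $((1),(1),(1))$; $((3^2),(2^3),(2,1,1,1,1))$; $((4,2),(2^3),(1^6))$; $((m+1,m),(m,m,1),(1^{2m+1}))$ with $m\ge2$; $((m,m),(m,m-1,1),(1^{2m}))$ with $m\ge 2$; $((n-1,1),(1^n),(1^n))$ with $n\ge 2$. Then the corresponding indecomposable object $I_{\mathbf d}$ in $\mathcal F_{p,q,r}$ can be presented in standard form with the collection of subsets $S_1,\ldots,S_a$ ($a=a_1$) chosen as in the following list. - $((1),(1),(1))$: $S_1=\{1\}$. - $((4,2),(2^3),(1^6))$: $S_1=\{1,5\}$, $S_2=\{2,3\}$, $S_3=\{2,5,6\}$, $S_4=\{4,5\}$. - $((3^2),(2^3),(2,1,1,1,1))$: $S_1=\{1,2,3\}$, $S_2=\{1,6\}$, $S_3=\{2,4,5\}$. - $((3^2),(2^3),(1,1,2,1,1))$: $S_1=\{1,5,6\}$, $S_2=\{2,3,6\}$, $S_3=\{4,5\}$. - $((3^2),(2^3),(1,1,1,1,2))$: $S_1=\{1,4,6\}$, $S_2=\{2,4,5\}$, $S_3=\{2,3\}$. - $((3^2),(2^3),(1,2,1,1,1))$: $S_1=\{1,2,4,6\}$, $S_2=\{1,3\}$, $S_3=\{1,5\}$. - $((3^2),(2^3),(1,1,1,2,1))$: $S_1=\{1,2,4,6\}$, $S_2=\{1,3\}$, $S_3=\{1,5\}$. - $((2,4),(2^3),(1^6))$: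 $S_1=\{1,2,3,6\}$, $S_2=\{1,4,5\}$. For $m\ge 2$: - $((m,m+1),(1,m,m),(1^{2m+1}))$: $S_k=\{1,k+1,2m+2-k\}$ $(1\le k\le m)$. - $((m+1,m),(1,m,m),(1^{2m+1}))$: $S_1=\{1,2\}$, $S_k=\{1,k+1,2m+3-k\}$ $(2\le k\le m)$, $S_{m+1}=\{1,m+2\}$. - $((m,m+1),(m,1,m),(1^{2m+1}))$: $S_k=\{k,m+1,2m+2-k\}$ $(1\le k\le m)$. - $((m+1,m),(m,1,m),(1^{2m+1}))$: $S_1=\{1,m+1\}$, $S_k=\{k,m+1,2m+3-k\}$ $(2\le k\le m)$, $S_{m+1}=\{m+1,m+2\}$. - $((m,m+1),(m,m,1),(1^{2m+1}))$: $S_k=\{k,2m+1-k,2m+1\}$ $(1\le k\le m)$. - $((m+1,m),(m,m,1),(1^{2m+1}))$: $S_1=\{1,2m+1\}$, $S_k=\{k,2m+2-k,2m+1\}$ $(2\le k\le m)$, $S_{m+1}=\{m+1,2m+1\}$. - $((m,m),(1,m-1,m),(1^{2m}))$: $S_k=\{1,k+1,2m+1-k\}$ $(1\le k\le m-1)$, $S_m=\{1,m+1\}$. - $((m,m),(1,m,m-1),(1^{2m}))$: $S_1=\{1,2\}$, $S_k=\{1,k+1,2m+2-k\}$ $(2\le k\le m)$. - $((m,m),(m-1,1,m),(1^{2m}))$: $S_k=\{k,m,2m+1-k\}$ $(1\le k\le m-1)$, $S_m=\{m,m+1\}$. - $((m,m),(m,1,m-1),(1^{2m}))$: $S_1=\{1,m+1\}$,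 $S_k=\{k,m+1,2m+2-k\}$ $(2\le k\le m)$. - $((m,m),(m-1,m,1),(1^{2m}))$: $S_k=\{k,2m-k,2m\}$ $(1\le k\le m-1)$, $S_m=\{m,2m\}$. - $((m,m),(m,m-1,1),(1^{2m}))$: $S_1=\{1,2m\}$, $S_k=\{k,2m+1-k,2m\}$ $(2\le k\le m)$. For $n\ge 2$: - $((n-1,1),(1^n),(1^n))$: $S_k=\{1,k+1\}$ $(1\le k\le n-1)$. - $((1,n-1),(1^n),(1^n))$: $S_1=\{1,2,\ldots,n\}$.
   Context: All vector spaces are finite-dimensional over a fixed algebraically closed field. A composition is a list $\mathbf a=(a_1,\ldots,a_p)$ of nonnegative integers; $|\mathbf a|=a_1+\cdots+a_p$, $\|\mathbf a\|^2=a_1^2+\cdots+a_p^2$, $\ell(\mathbf a)=p$. $(a^p)$ denotes $(a,\ldots,a)$ with $p$ parts. For $\dim V=|\mathbf a|$, $\mathrm{Fl}_{\mathbf a}(V)$ is the variety of flags $A=(0=A_0\subset A_1\subset\cdots\subset A_p=V)$ with $\dim(A_i/A_{i-1})=a_i$. $\Lambda_{p,q,r}$ is the additive semigroup of triples of compositions $(\mathbf a,\mathbf b,\mathbf c)$ with $(\ell(\mathbf a),\ell(\mathbf b),\ell(\mathbf c))=(p,q,r)$ and $|\mathbf a|=|\mathbf b|=|\mathbf c|$. A triple is of finite type if $GL(V)$, acting diagonally, has finitely many orbits in $\mathrm{Fl}_{\mathbf a}(V)\times\mathrm{Fl}_{\mathbf b}(V)\times\mathrm{Fl}_{\mathbf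 c}(V)$. The Tits form is $Q(\mathbf a,\mathbf b,\mathbf c)=\tfrac12(\|\mathbf a\|^2+\|\mathbf b\|^2+\|\mathbf c\|^2-|\mathbf a|^2)$. $\Pi_{p,q,r}$ is the set of all $\mathbf d\in\Lambda_{p,q,r}$ of finite type with $Q(\mathbf d)=1$. $\mathcal F_{p,q,r}$ is the additive category whose objects are $(V;A,B,C)$ with $(A,B,C)\in\mathrm{Fl}_{\mathbf a}(V)\times\mathrm{Fl}_{\mathbf b}(V)\times\mathrm{Fl}_{\mathbf c}(V)$ for some $(\mathbf a,\mathbf b,\mathbf c)\in\Lambda_{p,q,r}$ (the dimension vector); morphisms $(V;A,B,C)\to(V';A',B',C')$ are linear maps $f:V\to V'$ with $f(A_i)\subset A_i'$, $f(B_i)\subset B_i'$, $f(C_i)\subset C_i'$ for all $i$; direct sums are componentwise. For $\mathbf d\in\Pi_{p,q,r}$, $I_{\mathbf d}$ denotes the unique isomorphism class of indecomposable objects of $\mathcal F_{p,q,r}$ with dimension vector $\mathbf d$. Standard form: an object $(V;A,B,C)$ of $\mathcal F_{p,q,r}$ with dimension vector $(\mathbf a,\mathbf b,\mathbf c)$ is presented in standard form if $V$ is given a basis $e_1,\ldots,e_n$ such that: (1) each $B_i$ has as basis the first $b_1+\cdots+b_i$ basis vectors $e_1,e_2,\ldots$, and each $C_i$ has as basis the last $c_1+\cdots+c_i$ basis vectors $e_n,e_{n-1},\ldots$; (2) $p\le 2$, and the subspace $A_1\subset V$ of dimension $a=a_1$ has basis $\sum_{l\in S_1}e_l,\ldots,\sum_{l\in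 S_a}e_l$ for some subsets $S_1,\ldots,S_a\subset\{1,\ldots,n\}$; (3) $\bigl|\bigcup_{k\ne k'}(S_k\cap S_{k'})\bigr|\le 2$. *)

(* Defs.v *)
From HB Require Import structures.
From mathcomp Require Import all_boot all_order all_algebra.

Set Implicit Arguments.
Unset Strict Implicit.
Unset Printing Implicit Defensive.

Import GRing.Theory.
Local Open Scope ring_scope.

(* A composition with p parts is a p.-tuple nat; |a| is sumn a. *)

Definition norm_sq (a : seq nat) : nat := (\sum_(x <- a) x ^ 2)%N.

Definition in_Lambda (a b c : seq nat) : Prop :=
  sumn a = sumn b /\ sumn b = sumn c.

Definition tits_form (a b c : seq nat) : rat :=
  2%:R^-1 * ((norm_sq a + norm_sq b + norm_sq c)%N%:R - (sumn a ^ 2)%N%:R).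

Section Flags.
Variables (k : fieldType) (V : vectType k).

(* The entries of the tuple are A_0, A_1, ..., A_p. *)
Definition is_flag p (A : p.+1.-tuple {vspace V}) : Prop :=
  [/\ tnth A ord0 = 0%VS, tnth A ord_max = fullv &
      forall i : 'I_p,
        (tnth A (widen_ord (leqnSn p) i) <= tnth A (lift ord0 i))%VS].

Record flag p := Flag {
  flag_val :> p.+1.-tuple {vspace V};
  flagP : is_flag flag_val
}.

Definition flag_type p (A : p.+1.-tuple {vspace V}) : p.-tuple nat :=
  [tuple (\dim (tnth A (lift ord0 i)) - \dim (tnth A (widen_ord (leqnSn p) i)))%N
     | i < p].

Definition flag_act p (g : 'End(V)) (A : p.+1.-tuple {vspace V}) :
    p.+1.-tuple {vspace V} :=
  map_tuple (lfun_img g) A.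

(* GL(V) has finitely many orbits in Fl_a(V) x Fl_b(V) x Fl_c(V): there is a
   finite family of triples of flags meeting every orbit. *)
Definition finitely_many_orbits p q r
    (a : p.-tuple nat) (b : q.-tuple nat) (c : r.-tuple nat) : Prop :=
  exists (N : nat) (F : 'I_N -> flag p * flag q * flag r),
  forall (A : flag p) (B : flag q) (C : flag r),
    flag_type A = a -> flag_type B = b -> flag_type C = c ->
    exists (i : 'I_N) (g : 'End(V)),
      [/\ lker g = 0%VS,
          flag_act g (F i).1.1 = A :> _.-tuple _,
          flag_act g (F i).1.2 = B :> _.-tuple _ &
          flag_act g (F i).2 = C :> _.-tuple _].

End Flags.

Definition finite_type (k : fieldType) p q r
    (a : p.-tuple nat) (b : q.-tuple nat) (c : r.-tuple nat) : Prop :=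
  forall V : vectType k, \dim (fullv : {vspace V}) = sumn a ->
    finitely_many_orbits V a b c.

Definition in_Pi (k : fieldType) p q r
    (a : p.-tuple nat) (b : q.-tuple nat) (c : r.-tuple nat) : Prop :=
  [/\ in_Lambda a b c, finite_type k a b c & tits_form a b c = 1].

Section Category.
Variables (k : fieldType) (p q r : nat).

Record triple_flag := TripleFlag {
  carrier : vectType k;
  flagA : flag carrier p;
  flagB : flag carrier q;
  flagC : flag carrier r
}.

Definition has_dim_vector (X : triple_flag)
    (a : p.-tuple nat) (b : q.-tuple nat) (c : r.-tuple nat) : Prop :=
  [/\ flag_type (flagA X) = a, flag_type (flagB X) = b &
      flag_type (flagC X) = c].

Definition is_morphism (X Y : triple_flag) (f : 'Hom(carrier X, carrier Y)) :
    Prop :=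
  [/\ forall i, (f @: tnth (flagA X) i <= tnth (flagA Y) i)%VS,
      forall i, (f @: tnth (flagB X) i <= tnth (flagB Y) i)%VS &
      forall i, (f @: tnth (flagC X) i <= tnth (flagC Y) i)%VS].

Definition isomorphic (X Y : triple_flag) : Prop :=
  exists (f : 'Hom(carrier X, carrier Y)) (g : 'Hom(carrier Y, carrier X)),
    [/\ is_morphism f, is_morphism g, (g \o f)%VF = \1%VF & (f \o g)%VF = \1%VF].

Definition is_zero_object (X : triple_flag) : Prop :=
  \dim (fullv : {vspace carrier X}) = 0%N.

End Category.

Section DirectSum.
Variables (k : fieldType).

Definition vs_prod (V W : vectType k) (U1 : {vspace V}) (U2 : {vspace W}) :
    {vspace (V * W)%type} :=
  ((linfun (fst : V * W -> V)) @^-1: U1 :&: (linfun (snd : V * W -> W)) @^-1: U2)%VS.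

Lemma mem_vs_prod (V W : vectType k) (U1 : {vspace V}) (U2 : {vspace W}) x :
  (x \in vs_prod U1 U2) = (x.1 \in U1) && (x.2 \in U2).
Proof. by rewrite memv_cap -!memv_preim !lfunE. Qed.

Definition flag_sum_val (V W : vectType k) p
    (A : p.+1.-tuple {vspace V}) (B : p.+1.-tuple {vspace W}) :
    p.+1.-tuple {vspace (V * W)%type} :=
  [tuple vs_prod (tnth A i) (tnth B i) | i < p.+1].

Lemma flag_sumP (V W : vectType k) p (A : flag V p) (B : flag W p) :
  is_flag (flag_sum_val A B).
Proof.
case: A B => [A [A0 Ap Ai]] [B [B0 Bp Bi]]; split=> [||i] /=.
- rewrite tnth_mktuple A0 B0; apply/vspaceP=> -[x y].
  by rewrite mem_vs_prod !memv0.
- by rewrite tnth_mktuple Ap Bp; apply/vspaceP=> x; rewrite mem_vs_prod !memvf.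
- rewrite !tnth_mktuple; apply/subvP=> x; rewrite !mem_vs_prod => /andP[x1 x2].
  by rewrite (subvP (Ai i)) // (subvP (Bi i)).
Qed.

Definition flag_sum (V W : vectType k) p (A : flag V p) (B : flag W p) :=
  Flag (flag_sumP A B).

Definition direct_sum p q r (X Y : triple_flag k p q r) : triple_flag k p q r :=
  TripleFlag (flag_sum (flagA X) (flagA Y)) (flag_sum (flagB X) (flagB Y))
    (flag_sum (flagC X) (flagC Y)).

Definition indecomposable p q r (X : triple_flag k p q r) : Prop :=
  ~ is_zero_object X /\
  forall Y Z : triple_flag k p q r, isomorphic X (direct_sum Y Z) ->
    is_zero_object Y \/ is_zero_object Z.

(* X lies in I_d, the unique isomorphism class of indecomposable objects with
   dimension vector d = (a, b, c); uniqueness is part of the description. *)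
Definition represents_I p q r
    (a : p.-tuple nat) (b : q.-tuple nat) (c : r.-tuple nat)
    (X : triple_flag k p q r) : Prop :=
  [/\ indecomposable X, has_dim_vector X a b c &
      forall Y : triple_flag k p q r,
        indecomposable Y -> has_dim_vector Y a b c -> isomorphic Y X].

End DirectSum.

Section StandardForm.
Variables (k : fieldType) (p q r : nat) (X : triple_flag k p q r).

(* The basis vectors are numbered from 0 here: e_l is tnth e (l - 1).  The
   subsets S_1, ..., S_(a_1) are the entries of S.  The dimension vector
   (a, b, c) is recovered from X, and nth 0%VS (flagA X) 1 is A_1. *)
Definition standard_form n (e : n.-tuple (carrier X)) (S : seq {set 'I_n}) :
    Prop :=
  let a := flag_type (flagA X) in
  let b := flag_type (flagB X) in
  let c := flag_type (flagC X) in
  [/\ basis_of fullv e,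
      (forall i : 'I_q.+1, basis_of (tnth (flagB X) i) (take (sumn (take i b)) e))
      /\ (forall i : 'I_r.+1,
            basis_of (tnth (flagC X) i) (take (sumn (take i c)) (rev e))),
      (p <= 2)%N,
      size S = nth 0%N a 0
      /\ basis_of (nth 0%VS (flagA X) 1)
           [seq \sum_(l in s) tnth e l | s : {set 'I_n} <- S] &
      (#|\bigcup_(i < size S) \bigcup_(j < size S | i != j)
          (nth set0 S i :&: nth set0 S j)| <= 2)%N].

(* A subset of {1, ..., n} given by listing its elements. *)
Definition set_of_list n (s : seq nat) : {set 'I_n} :=
  [set l : 'I_n | l.+1 \in s].

Definition presented_in_standard_form (S : seq (seq nat)) : Prop :=
  exists (n : nat) (e : n.-tuple (carrier X)),
    all (all (fun l => (1 <= l <= n)%N)) S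
    /\ standard_form e [seq set_of_list n s | s <- S].

End StandardForm.

Local Open Scope nat_scope.

Inductive base_triple : seq nat -> seq nat -> seq nat -> Prop :=
| Base1 : base_triple [:: 1] [:: 1] [:: 1]
| Base_33 : base_triple [:: 3; 3] (nseq 3 2) [:: 2; 1; 1; 1; 1]
| Base_42 : base_triple [:: 4; 2] (nseq 3 2) (nseq 6 1)
| Base_odd m : 2 <= m ->
    base_triple [:: m.+1; m] [:: m; m; 1] (nseq (2 * m + 1) 1)
| Base_even m : 2 <= m ->
    base_triple [:: m; m] [:: m; m - 1; 1] (nseq (2 * m) 1)
| Base_hyp n : 2 <= n ->
    base_triple [:: n - 1; 1] (nseq n 1) (nseq n 1).

Definition permuted_base_triple (a b c : seq nat) : Prop :=
  exists a0 b0 c0, base_triple a0 b0 c0 /\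
    [/\ perm_eq a a0, perm_eq b b0 & perm_eq c c0].

Inductive listed : seq nat -> seq nat -> seq nat -> seq (seq nat) -> Prop :=
| L_1 : listed [:: 1] [:: 1] [:: 1] [:: [:: 1]]
| L_42 : listed [:: 4; 2] (nseq 3 2) (nseq 6 1)
    [:: [:: 1; 5]; [:: 2; 3]; [:: 2; 5; 6]; [:: 4; 5]]
| L_33_1 : listed [:: 3; 3] (nseq 3 2) [:: 2; 1; 1; 1; 1]
    [:: [:: 1; 2; 3]; [:: 1; 6]; [:: 2; 4; 5]]
| L_33_3 : listed [:: 3; 3] (nseq 3 2) [:: 1; 1; 2; 1; 1]
    [:: [:: 1; 5; 6]; [:: 2; 3; 6]; [:: 4; 5]]
| L_33_5 : listed [:: 3; 3] (nseq 3 2) [:: 1; 1; 1; 1; 2]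
    [:: [:: 1; 4; 6]; [:: 2; 4; 5]; [:: 2; 3]]
| L_33_2 : listed [:: 3; 3] (nseq 3 2) [:: 1; 2; 1; 1; 1]
    [:: [:: 1; 2; 4; 6]; [:: 1; 3]; [:: 1; 5]]
| L_33_4 : listed [:: 3; 3] (nseq 3 2) [:: 1; 1; 1; 2; 1]
    [:: [:: 1; 2; 4; 6]; [:: 1; 3]; [:: 1; 5]]
| L_24 : listed [:: 2; 4] (nseq 3 2) (nseq 6 1)
    [:: [:: 1; 2; 3; 6]; [:: 1; 4; 5]]
| L_odd_1mm m : 2 <= m ->
    listed [:: m; m.+1] [:: 1; m; m] (nseq (2 * m + 1) 1)
      [seq [:: 1; k + 1; 2 * m + 2 - k] | k <- index_iota 1 m.+1]
| L_odd'_1mm m : 2 <= m ->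
    listed [:: m.+1; m] [:: 1; m; m] (nseq (2 * m + 1) 1)
      ([:: 1; 2] ::
       [seq [:: 1; k + 1; 2 * m + 3 - k] | k <- index_iota 2 m.+1]
       ++ [:: [:: 1; m + 2]])
| L_odd_m1m m : 2 <= m ->
    listed [:: m; m.+1] [:: m; 1; m] (nseq (2 * m + 1) 1)
      [seq [:: k; m + 1; 2 * m + 2 - k] | k <- index_iota 1 m.+1]
| L_odd'_m1m m : 2 <= m ->
    listed [:: m.+1; m] [:: m; 1; m] (nseq (2 * m + 1) 1)
      ([:: 1; m + 1] ::
       [seq [:: k; m + 1; 2 * m + 3 - k] | k <- index_iota 2 m.+1]
       ++ [:: [:: m + 1; m + 2]])
| L_odd_mm1 m : 2 <= m ->
    listed [:: m; m.+1] [:: m; m; 1] (nseq (2 * m + 1) 1)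
      [seq [:: k; 2 * m + 1 - k; 2 * m + 1] | k <- index_iota 1 m.+1]
| L_odd'_mm1 m : 2 <= m ->
    listed [:: m.+1; m] [:: m; m; 1] (nseq (2 * m + 1) 1)
      ([:: 1; 2 * m + 1] ::
       [seq [:: k; 2 * m + 2 - k; 2 * m + 1] | k <- index_iota 2 m.+1]
       ++ [:: [:: m + 1; 2 * m + 1]])
| L_even_1_m1_m m : 2 <= m ->
    listed [:: m; m] [:: 1; m - 1; m] (nseq (2 * m) 1)
      ([seq [:: 1; k + 1; 2 * m + 1 - k] | k <- index_iota 1 m]
       ++ [:: [:: 1; m + 1]])
| L_even_1_m_m1 m : 2 <= m ->
    listed [:: m; m] [:: 1; m; m - 1] (nseq (2 * m) 1)
      ([:: 1; 2] ::
       [seq [:: 1; k + 1; 2 * m + 2 - k] | k <- index_iota 2 m.+1])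
| L_even_m1_1_m m : 2 <= m ->
    listed [:: m; m] [:: m - 1; 1; m] (nseq (2 * m) 1)
      ([seq [:: k; m; 2 * m + 1 - k] | k <- index_iota 1 m]
       ++ [:: [:: m; m + 1]])
| L_even_m_1_m1 m : 2 <= m ->
    listed [:: m; m] [:: m; 1; m - 1] (nseq (2 * m) 1)
      ([:: 1; m + 1] ::
       [seq [:: k; m + 1; 2 * m + 2 - k] | k <- index_iota 2 m.+1])
| L_even_m1_m_1 m : 2 <= m ->
    listed [:: m; m] [:: m - 1; m; 1] (nseq (2 * m) 1)
      ([seq [:: k; 2 * m - k; 2 * m] | k <- index_iota 1 m]
       ++ [:: [:: m; 2 * m]])
| L_even_m_m1_1 m : 2 <= m ->
    listed [:: m; m] [:: m; m - 1; 1] (nseq (2 * m) 1)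
      ([:: 1; 2 * m] ::
       [seq [:: k; 2 * m + 1 - k; 2 * m] | k <- index_iota 2 m.+1])
| L_hyp n : 2 <= n ->
    listed [:: n - 1; 1] (nseq n 1) (nseq n 1)
      [seq [:: 1; k + 1] | k <- index_iota 1 n]
| L_line n : 2 <= n ->
    listed [:: 1; n - 1] (nseq n 1) (nseq n 1) [:: index_iota 1 n.+1].

(* Main.v *)
From HB Require Import structures.
Require Import Defs.
From mathcomp Require Import all_boot all_order all_algebra.
From mathcomp Require Import zify.

(* Let X be the triple of flags on k^n described by the subsets S_1, ..., S_a.
   Preserving the coordinate flags B and C forces many entries of the matrix
   (M j l) of an endomorphism of X to vanish; preserving A_1 means that
     sum_(j in S_i) M j l = sum_(i' | l in S_i') N i i'   for all i and l,
   where N is the matrix of the restriction to A_1.  In every listed case these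
   equations, in any characteristic, force M to be scalar, so X has
   only trivial idempotents and is indecomposable.  When b has three parts and
   c = (1^n), all S_i share one index s, and the rest of {1, ..., n} is split
   between two blocks of B along which the S_i run in opposite directions:
   triangularity of M on both blocks makes N diagonal, and the column l = s
   makes N scalar.
   If X' represents I_d, then X' is isomorphic to X, and the basis is
   transported along the isomorphism. *)

Set Implicit Arguments.
Unset Strict Implicit.
Unset Printing Implicit Defensive.

Import GRing.Theory.
Local Open Scope ring_scope.

(** * Flags with prescribed dimensions, bricks, and transport along isomorphisms *)

(** The dimension formula at i = 0 and i = p already forces U 0 = 0 and U p = V. *)
Lemma flag_of_dims (k : fieldType) (V : vectType k) p (a : p.-tuple nat)
    (U : nat -> {vspace V}) :
  (forall i, (i < p)%N -> (U i <= U i.+1)%VS) ->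
  (forall i, (i <= p)%N -> \dim (U i) = sumn (take i a)) ->
  \dim (fullv : {vspace V}) = sumn a ->
  exists2 F : flag V p, flag_type F = a & forall i : 'I_p.+1, tnth F i = U i.
Proof.
move=> U_mono dimU dimV.
have flagU : is_flag [tuple U i | i < p.+1].
  split=> [||i]; rewrite !tnth_mktuple.
  - by apply/eqP; rewrite -dimv_eq0 dimU // take0.
  - by apply/eqP; rewrite eqEdim subvf dimV dimU //= take_oversize ?size_tuple.
  - by rewrite lift0; exact: U_mono (ltn_ord i).
exists (Flag flagU) => [|i]; last by rewrite tnth_mktuple.
apply: eq_from_tnth => i; rewrite !tnth_mktuple lift0 /=.
rewrite !dimU //; last exact: ltnW.
by rewrite (take_nth 0%N) ?size_tuple // sumn_rcons addKn -tnth_nth.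
Qed.

(** Conjugating the projection onto Y into End(X) yields a scalar c, so the projection itself is
    multiplication by c: c = 0 kills Y and c != 0 kills Z. *)
Lemma brick_indecomposable (k : fieldType) p q r (X : triple_flag k p q r) :
  ~ is_zero_object X ->
  (forall f : 'End(carrier X), is_morphism f -> exists c, f = c *: \1%VF) ->
  indecomposable X.
Proof.
move=> X_neq0 X_brick; split=> // Y Z [f [g [fM gM gfK fgK]]].
set T := (carrier Y * carrier Z)%type.
pose h (u : T) : T := (u.1, 0).
have h_lin : linear h by move=> c x y; congr (_, _); rewrite /= scaler0 addr0.
pose hL : {linear T -> T} := HB.pack h (GRing.isLinear.Build _ _ _ _ _ h_lin).
pose P : 'End(T) := linfun hL.
have PE u : P u = (u.1, 0) by rewrite lfunE.
have PM : is_morphism (X := direct_sum Y Z) (Y := direct_sum Y Z) P.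
  split=> i; rewrite /= !tnth_mktuple; apply/subvP=> _ /memv_imgP[u + ->];
    by rewrite PE !mem_vs_prod mem0v /= => /andP[-> _].
have [c gPf] : exists c, (g \o P \o f)%VF = c *: \1%VF.
  apply: X_brick; case: fM gM PM => [fA fB fC] [gA gB gC] [PA PB PC].
  by split=> i; rewrite !limg_comp;
     [ apply: subv_trans (gA i) | apply: subv_trans (gB i)
     | apply: subv_trans (gC i) ]; apply: limgS;
     [ apply: subv_trans (PA i) | apply: subv_trans (PB i)
     | apply: subv_trans (PC i) ]; apply: limgS.
have fK x : g (f x) = x by rewrite -comp_lfunE gfK id_lfunE.
have gK x : f (g x) = x by rewrite -comp_lfunE fgK id_lfunE.
have Pc u : P u = c *: u.
  have := congr1 f (erefl ((g \o P \o f)%VF (g u))).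
  by rewrite {1}gPf scale_lfunE id_lfunE linearZ !comp_lfunE /= !gK => ->.
have [c0|c_neq0] := eqVneq c 0; [left | right];
  apply/eqP; rewrite dimv_eq0 -subv0; apply/subvP=> x _; rewrite memv0.
- by have := Pc (x, 0); rewrite PE c0 scale0r => -[->].
- have := Pc (0, x); rewrite PE => -[_ /esym/eqP].
  by rewrite scaler_eq0 (negPf c_neq0).
Qed.

(** Mutually inverse morphisms carry each flag member exactly onto its counterpart, hence bases onto
    bases. *)
Lemma presented_iso (k : fieldType) p q r (a : p.-tuple nat) (b : q.-tuple nat)
    (c : r.-tuple nat) (X Y : triple_flag k p q r) S :
  isomorphic Y X -> has_dim_vector X a b c -> has_dim_vector Y a b c ->
  presented_in_standard_form Y S -> presented_in_standard_form X S.
Proof.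
move=> [f [g [[fA fB fC] [gA gB gC] gfK fgK]]] [Xa Xb Xc] [Ya Yb Yc].
have fK : cancel f g by move=> x; rewrite -comp_lfunE gfK id_lfunE.
have gK : cancel g f by move=> x; rewrite -comp_lfunE fgK id_lfunE.
have imf (U : {vspace carrier Y}) (W : {vspace carrier X}) :
    (f @: U <= W)%VS -> (g @: W <= U)%VS -> (f @: U)%VS = W.
  move=> fU gW; apply/eqP; rewrite eqEsubv fU; apply/subvP=> x xW.
  by rewrite -(gK x) memv_img // (subvP gW) // memv_img.
have kerf : lker f = 0%VS by apply/eqP/lker0P; apply: can_inj fK.
have imf_basis (U : {vspace carrier Y}) (W : {vspace carrier X}) s :
    (f @: U <= W)%VS -> (g @: W <= U)%VS -> basis_of U s ->
    basis_of W (map f s).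
  move=> fU gW /(limg_basis_of (f := f)); rewrite kerf capv0 => /(_ erefl).
  by rewrite (imf U W).
move=> [n [e [rangeS]]]; rewrite /standard_form; lazy zeta; rewrite Ya Yb Yc.
move=> [e_basis [B_basis C_basis] p2 [sizeS A_basis] overlapS].
exists n, (map_tuple f e); split=> //.
rewrite /standard_form; lazy zeta; rewrite Xa Xb Xc; split=> //.
- by apply: imf_basis e_basis; apply: subvf.
- by split=> i; rewrite -?map_rev -map_take;
    [apply: imf_basis (B_basis i) | apply: imf_basis (C_basis i)].
split=> //.
have -> : [seq \sum_(l in s) tnth [tuple of map f e] l
            | s : {set 'I_n} <- [seq set_of_list n s | s <- S]]
        = map f [seq \sum_(l in s) tnth e l
            | s : {set 'I_n} <- [seq set_of_list n s | s <- S]].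
  rewrite -[RHS]map_comp; apply: eq_map => s /=; rewrite linear_sum /=.
  by apply: eq_bigr => l _; rewrite tnth_map.
apply: imf_basis A_basis.
(* For p = 0 there is no A_1, and [nth 0%VS] defaults to the zero subspace on both sides. *)
- have [p1|p1] := ltnP 1 p.+1.
    by have := fA (Ordinal p1); rewrite !(tnth_nth 0%VS).
  by rewrite !nth_default ?size_tuple // limg0.
- have [p1|p1] := ltnP 1 p.+1.
    by have := gA (Ordinal p1); rewrite !(tnth_nth 0%VS).
  by rewrite !nth_default ?size_tuple // limg0.
Qed.

(** * Combinatorial conditions on the subsets *)

(* With 1-based indices, "compatible b c j l" says that an endomorphism
   preserving the flags B and C may have a nonzero e_l-coefficient in the image
   of e_j; C is built from the last basis vectors. *)
Definition compatible (b c : seq nat) (j l : nat) : bool :=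
  all (fun i => (j <= sumn (take i b)) ==> (l <= sumn (take i b)))%N
      (iota 0 (size b).+1) &&
  all (fun i => (sumn c - sumn (take i c) < j) ==>
                (sumn c - sumn (take i c) < l))%N
      (iota 0 (size c).+1).

(** The brick property as a system of equations, free of linear algebra. Matrices are total
    functions on naturals: basis indices start at 1, subset indices at 0. *)
Definition rigid (k : nzRingType) (R : rel nat) (n : nat) (S : seq (seq nat)) :=
  forall M N : nat -> nat -> k,
    (forall j l, ~~ R j l -> M j l = 0) ->
    (forall i l, (i < size S)%N -> (1 <= l <= n)%N ->
       \sum_(1 <= j < n.+1 | j \in nth [::] S i) M j l =
       \sum_(0 <= i' < size S | l \in nth [::] S i') N i i') ->
  exists x, forall j, (1 <= j <= n)%N -> forall l, (1 <= l <= n)%N ->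
    M j l = x *+ (j == l).

(* Each subset owns an index, so the vectors \sum_(l in S_i) e_l are free. *)
Definition separated (S : seq (seq nat)) :=
  forall i, (i < size S)%N -> exists2 l, l \in nth [::] S i &
    forall i', (i' < size S)%N -> l \in nth [::] S i' -> i' = i.

(** Naming two indices that contain all overlaps gives the bound 2 of condition (3); x = y is
    allowed. *)
Definition overlap_in (x y : nat) (S : seq (seq nat)) :=
  forall i j l, (i < size S)%N -> (j < size S)%N -> i <> j ->
    l \in nth [::] S i -> l \in nth [::] S j -> l \in [:: x; y].

(** * From the combinatorial conditions to an object in standard form *)

Section CoordinateFlags.
Variables (k : fieldType) (n : nat).

Definition std_basis : n.-tuple 'rV[k]_n := [tuple delta_mx 0 i | i < n].

Lemma std_basisP : basis_of fullv std_basis.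
Proof.
rewrite basisEdim dimvf dim_matrix mul1r size_tuple leqnn andbT.
apply/subvP=> v _; rewrite (row_sum_delta v); apply: rpred_sum => i _.
by apply/rpredZ/memv_span/map_f; rewrite mem_enum.
Qed.

Lemma dim_span_take (s : n.-tuple 'rV[k]_n) t :
  free s -> (t <= n)%N ->
  basis_of <<take t s>>%VS (take t s) /\ \dim <<take t s>> = t.
Proof.
rewrite -{1}(cat_take_drop t s) => /catl_free free_t le_tn.
split; first by rewrite /basis_of eqxx.
by move: free_t; rewrite /free => /eqP->; rewrite size_takel ?size_tuple.
Qed.

Lemma mem_take_enum t (i : 'I_n) : (i \in take t (enum 'I_n)) = (i < t)%N.
Proof.
rewrite -(mem_map val_inj) map_take val_enum_ord take_iota mem_iota add0n.
by rewrite leq0n leq_min ltn_ord andbT.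
Qed.

Lemma mem_take_rev_enum t (i : 'I_n) :
  (i \in take t (rev (enum 'I_n))) = (n - t <= i)%N.
Proof.
rewrite take_rev mem_rev size_enum_ord -(mem_map val_inj) map_drop val_enum_ord.
by rewrite drop_iota mem_iota add0n subnKC ?leq_subr // ltn_ord andbT.
Qed.

Lemma coord_span0 (s : seq 'rV[k]_n) v l :
  (forall x, x \in s -> x 0 l = 0) -> v \in <<s>>%VS -> v 0 l = 0.
Proof.
move=> s0 /(@coord_span _ _ _ (in_tuple s)) ->; rewrite summxE big1 // => i _.
by rewrite mxE s0 ?mulr0 // mem_nth.
Qed.

Lemma indicator_coord (A : {set 'I_n}) l :
  (\sum_(j in A) tnth std_basis j) 0 l = (l \in A)%:R.
Proof.
rewrite summxE; have [lA|lA] := boolP (l \in A).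
  rewrite (bigD1 l) //= big1 => [|j /andP[_ jl]]; rewrite tnth_mktuple mxE eqxx.
    by rewrite eqxx addr0.
  by rewrite eq_sym (negPf jl).
rewrite big1 // => j jA; rewrite tnth_mktuple mxE eqxx /=.
by case: eqP lA => // ->; rewrite jA.
Qed.

Lemma indicators_free (S : seq (seq nat)) :
  separated S -> all (all (fun l => (1 <= l <= n)%N)) S ->
  free [seq \sum_(l in s) tnth std_basis l
          | s : {set 'I_n} <- [seq set_of_list n s | s <- S]].
Proof.
move=> sepS rangeS; set vs := map _ _.
have size_vs : size vs = size S by rewrite !size_map.
change (free (in_tuple vs)); apply/freeP => x x0 i.
have iS : (i < size S)%N by rewrite -size_vs.
have [l lS l_only] := sepS _ iS.
have /andP[l1 ln] := allP (allP rangeS _ (mem_nth [::] iS)) l lS.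
have l'n : (l.-1 < n)%N by rewrite prednK.
(* At the index owned by subset i, only the i-th term of the linear relation survives. *)
have := congr1 (fun v : 'rV_n => v 0 (Ordinal l'n)) x0.
rewrite summxE (bigD1 i) //= big1 => [|j ji]; rewrite !mxE.
  rewrite (nth_map set0) ?size_map // (nth_map [::]) // indicator_coord inE /=.
  by rewrite prednK // lS mulr1 addr0.
have jS : (j < size S)%N by rewrite -size_vs.
rewrite (nth_map set0) ?size_map // (nth_map [::]) // indicator_coord inE /=.
rewrite prednK //; have [/(l_only _ jS) ji'|] := boolP (l \in _); last first.
  by rewrite mulr0.
by case/eqP: ji; apply: val_inj.
Qed.

End CoordinateFlags.

Lemma card_set_of_list n s : (#|set_of_list n s| <= size s)%N.
Proof.
rewrite cardE -(size_map (fun i : 'I_n => i.+1)); apply: uniq_leq_size.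
  by rewrite map_inj_uniq ?enum_uniq // => i j [] /val_inj.
by move=> _ /mapP[i + ->]; rewrite mem_enum inE.
Qed.

(** [separated] gives A_1 its dimension, [overlap_in] gives condition (3), and [rigid] makes the
    coordinate object a brick. *)
Lemma standard_object (k : fieldType) p q r (a : p.-tuple nat) (b : q.-tuple nat)
    (c : r.-tuple nat) (S : seq (seq nat)) x y :
  (0 < p <= 2)%N -> (0 < sumn a)%N -> sumn b = sumn a -> sumn c = sumn a ->
  size S = nth 0%N a 0 ->
  all (all (fun l => (1 <= l <= sumn a)%N)) S ->
  separated S -> overlap_in x y S -> rigid k (compatible b c) (sumn a) S ->
  exists X : triple_flag k p q r,
    [/\ indecomposable X, has_dim_vector X a b c &
        presented_in_standard_form X S].
Proof.
move=> /andP[p_gt0 p_le2] a_gt0 sum_b sum_c sizeS rangeS sepS overS rigS.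
set n := sumn a in a_gt0 sum_b sum_c rangeS rigS *.
pose e := std_basis k n.
have dimV : \dim (fullv : {vspace 'rV[k]_n}) = n by rewrite dimvf dim_matrix mul1r.
have free_e : free e := basis_free (std_basisP k n).
have free_re : free (rev_tuple e).
  by rewrite (perm_free (Y := e)) // perm_rev.
pose vs : seq 'rV[k]_n := [seq \sum_(l in s) tnth e l
          | s : {set 'I_n} <- [seq set_of_list n s | s <- S]].
have free_vs : free vs := indicators_free k sepS rangeS.
have sumn_take_le m (s : m.-tuple nat) i : (sumn (take i s) <= sumn s)%N.
  by rewrite -{2}(cat_take_drop i s) sumn_cat leq_addr.
have sumn_take_mono m (s : m.-tuple nat) i :
    (sumn (take i s) <= sumn (take i.+1 s))%N.
  by rewrite -(cat_take_drop i (take i.+1 s)) take_takel // sumn_cat leq_addr.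
have take_span_mono (s : seq 'rV[k]_n) t u :
    (t <= u)%N -> (<<take t s>> <= <<take u s>>)%VS.
  move=> tu.
  by rewrite -(cat_take_drop t (take u s)) take_takel // span_cat addvSl.
pose UA i : {vspace 'rV[k]_n} :=
  match i with 0 => 0%VS | 1 => <<vs>>%VS | _ => fullv end.
have [A dimA AE] : exists2 F : flag 'rV[k]_n p, flag_type F = a &
    forall i : 'I_p.+1, tnth F i = UA i.
  apply: flag_of_dims => //; first by case=> [|[|i]] _ //=; rewrite ?sub0v ?subvf.
  have size_a : size a = p by rewrite size_tuple.
  case=> [|[|i]] ip /=; first by rewrite take0 dimv0.
    move: free_vs; rewrite /free => /eqP->; rewrite !size_map sizeS.
    by case: (a : seq nat) => [|x0 s] //=; rewrite take0 addn0.
  by rewrite take_oversize // size_a; case: (p) p_le2 => [|[|[|]]].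
have [B dimB BE] : exists2 F : flag 'rV[k]_n q, flag_type F = b &
    forall i : 'I_q.+1, tnth F i = <<take (sumn (take i b)) e>>%VS.
  apply: (flag_of_dims (U := fun i => <<take (sumn (take i b)) e>>%VS))
    => [i _|i _|]; [exact: take_span_mono| |by rewrite dimV].
  by case: (dim_span_take free_e (_ : (sumn (take i b) <= n)%N)); rewrite -?sum_b.
have [C dimC CE] : exists2 F : flag 'rV[k]_n r, flag_type F = c &
    forall i : 'I_r.+1, tnth F i = <<take (sumn (take i c)) (rev e)>>%VS.
  apply: (flag_of_dims (U := fun i => <<take (sumn (take i c)) (rev e)>>%VS))
    => [i _|i _|]; [exact: take_span_mono| |by rewrite dimV].
  by case: (dim_span_take free_re (_ : (sumn (take i c) <= n)%N)); rewrite -?sum_c.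
pose X := TripleFlag A B C.
have dimX : has_dim_vector X a b c by split.
have A1E : nth 0%VS A 1 = <<vs>>%VS.
  by rewrite -(tnth_nth 0%VS A (Ordinal (p_gt0 : 1 < p.+1)%N)) AE.
exists X; split=> //.
- apply: brick_indecomposable => [|f [fA fB fC]].
    by rewrite /is_zero_object dimV => n0; move: a_gt0; rewrite n0.
  (* Extending the basis by 0 outside 1..n lets M be defined on all naturals. *)
  pose e_ j : 'rV[k]_n := \row_i (i.+1 == j)%:R.
  have e_E (i : 'I_n) : e_ i.+1 = delta_mx 0 i.
    by apply/rowP=> l; rewrite !mxE eqSS eqxx.
  have e_P j : (exists i : 'I_n, j = i.+1) \/ e_ j = 0.
    have [/andP[j_gt0 jn]|j_out] := boolP (1 <= j <= n)%N.
      have j'n : (j.-1 < n)%N by rewrite prednK.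
      by left; exists (Ordinal j'n); rewrite /= prednK.
    right; apply/rowP=> i; rewrite !mxE; case: eqP => // ij.
    by case/negP: j_out; rewrite -ij /= ltn_ord.
  pose M j l := (f (e_ j) *m (e_ l)^T) 0 0.
  have ME j (l : 'I_n) : M j l.+1 = f (e_ j) 0 l.
    by rewrite /M e_E trmx_delta -colE mxE.
  have fvs v : v \in <<vs>>%VS -> f v \in <<vs>>%VS.
    have := fA (Ordinal (p_gt0 : 1 < p.+1)%N); rewrite /= AE /= => /subvP fA1 v_in.
    exact/fA1/memv_img.
  pose N i i' := if insub i' is Some i0 then coord (in_tuple vs) i0 (f vs`_i) else 0.
  have [j l|i l iS l_range|x0 x0P] := rigS M N.
  - case: (e_P j) => [[j' ->]|ej0 _]; last by rewrite /M ej0 linear0 mul0mx mxE.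
    case: (e_P l) => [[l' ->]|el0 _]; last by rewrite /M el0 trmx0 mulmx0 mxE.
    (* Incompatibility means that some B_t or C_t contains e_j but not e_l; f preserves it, so
       f(e_j) has no e_l-coefficient. *)
    rewrite ME e_E negb_and -!has_predC => /orP[] /hasP[t];
      rewrite mem_iota add0n size_tuple => /= tq;
      rewrite negb_imply -?ltnNge => /andP[jt lt].
      have := fB (inord t); rewrite /= BE inordK // => /subvP fBt.
      apply: coord_span0 (fBt _ _) => [v|].
        rewrite -map_take => /mapP[i + ->]; rewrite mem_take_enum => it.
        by rewrite mxE eqxx; case: eqP => // ll; move: lt; rewrite ll ltnNge it.
      by apply/memv_img/memv_span; rewrite -map_take map_f // mem_take_enum.
    rewrite ltnS sum_c in jt lt.
    have := fC (inord t); rewrite /= CE inordK // => /subvP fCt.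
    apply: coord_span0 (fCt _ _) => [v|].
      rewrite -map_rev -map_take => /mapP[i + ->]; rewrite mem_take_rev_enum => it.
      by rewrite mxE eqxx; case: eqP => // ll; move: lt; rewrite ll ltnS ltnNge it.
    apply/memv_img/memv_span; rewrite -map_rev -map_take map_f //.
    by rewrite mem_take_rev_enum.
  (* Both sides are the l-th coordinate of f(v_i): on the left from the images of the e_j, on the
     right from the expansion of f(v_i) in the spanning vectors of A_1. *)
  - case/andP: l_range => l_gt0 ln; have l'n : (l.-1 < n)%N by rewrite prednK.
    have -> : l = (Ordinal l'n).+1 by rewrite /= prednK.
    set l' := Ordinal l'n.
    have size_vs : size vs = size S by rewrite !size_map.
    have vsE i' : (i' < size S)%N ->
        vs`_i' = \sum_(j in set_of_list n (nth [::] S i')) tnth e j.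
      by move=> i'S; rewrite (nth_map set0) ?size_map // (nth_map [::]).
    have -> : \sum_(1 <= j < n.+1 | j \in nth [::] S i) M j l'.+1 = f vs`_i 0 l'.
      rewrite vsE // linear_sum summxE big_add1 big_mkord.
      by apply: eq_big => j; rewrite ?inE // => _; rewrite ME e_E tnth_mktuple.
    have vsi : f vs`_i \in <<in_tuple vs>>%VS.
      by apply/fvs/memv_span/mem_nth; rewrite size_vs.
    rewrite {1}(coord_span vsi) summxE /=.
    pose G i' := N i i' * vs`_i' 0 l'.
    have -> : \sum_(i0 < size vs) (coord (in_tuple vs) i0 (f vs`_i) *: vs`_i0) 0 l'
            = \sum_(i0 < size vs) G i0.
      by apply: eq_bigr => i0 _; rewrite mxE /G /N valK.
    rewrite size_vs big_mkord [RHS]big_mkcond; apply: eq_bigr => i' _.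
    rewrite /G vsE // indicator_coord inE.
    by case: (_ \in nth _ _ _); rewrite ?mulr1 ?mulr0.
  exists x0; apply/lfunP=> v; rewrite scale_lfunE id_lfunE.
  rewrite (row_sum_delta v) linear_sum scaler_sumr; apply: eq_bigr => i _.
  rewrite linearZ /= scalerA mulrC -scalerA; congr (_ *: _).
  apply/rowP=> l; rewrite -e_E -ME x0P ?ltn_ord // !mxE eqSS /=.
  by rewrite mulr_natr eq_sym.
- exists n, e; split=> //; case: dimX => [Xa Xb Xc].
  rewrite /standard_form; lazy zeta; rewrite Xa Xb Xc; split=> //.
  + exact: std_basisP.
  + split=> i /=; rewrite ?BE ?CE.
      by case: (dim_span_take free_e (_ : (sumn (take i b) <= n)%N)); rewrite -?sum_b.
    by case: (dim_span_take free_re (_ : (sumn (take i c) <= n)%N)); rewrite -?sum_c.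
  + by rewrite size_map sizeS; split=> //=; rewrite A1E /basis_of eqxx.
  apply: leq_trans (card_set_of_list n [:: x; y]); apply/subset_leq_card/subsetP=> l.
  case/bigcupP=> i _ /bigcupP[j ij]; rewrite inE => /andP[].
  have iS : (i < size S)%N by rewrite -(size_map (set_of_list n)).
  have jS : (j < size S)%N by rewrite -(size_map (set_of_list n)).
  rewrite !(nth_map [::]) // !inE; move=> li lj.
  have := overS _ _ _ iS jS _ li lj; rewrite !inE; apply=> /val_inj ij'.
  by rewrite ij' eqxx in ij.
Qed.

(** * Rigidity when all subsets share one index *)

(** Away from s the subsets are disjoint, so the right-hand sum is a single entry of N; at most one
    element of a subset relates to a given l, so the left-hand sum has at most one nonzero entry of
    M. The last hypothesis kills the off-diagonal entries of N, and column s equates its diagonal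
    entries. *)
Lemma star_rigid (k : nzRingType) (R : rel nat) n s (S : seq (seq nat)) :
  (0 < size S)%N ->
  (forall i, (i < size S)%N -> {subset nth [::] S i <= iota 1 n}) ->
  (forall i, (i < size S)%N -> s \in nth [::] S i) ->
  (forall l, l \in iota 1 n -> l != s ->
     exists2 i, (i < size S)%N & l \in nth [::] S i) ->
  (forall i i' l, (i < size S)%N -> (i' < size S)%N -> l != s ->
     l \in nth [::] S i -> l \in nth [::] S i' -> i = i') ->
  (forall l, R l l) ->
  (forall i j j' l, (i < size S)%N -> j \in nth [::] S i -> j' \in nth [::] S i ->
     R j l -> R j' l -> j = j') ->
  (forall i i', (i < size S)%N -> (i' < size S)%N -> i != i' ->
     exists2 l, l \in nth [::] S i' &
       l != s /\ forall j, j \in nth [::] S i -> ~~ R j l) ->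
  rigid k R n S.
Proof.
move=> S_gt0 S_sub sS cover disj R_refl R_uniq sep M N M0 MN.
have iota_range l : (l \in iota 1 n) = (1 <= l <= n)%N by rewrite mem_iota add1n ltnS.
have N_col i l i' : (i < size S)%N -> (i' < size S)%N -> l != s ->
    l \in nth [::] S i' ->
    \sum_(0 <= i'' < size S | l \in nth [::] S i'') N i i'' = N i i'.
  move=> iS i'S ls li'.
  rewrite big_mkord (bigD1 (Ordinal i'S)) //= big1 ?addr0 // => j /andP[lj ji'].
  by case/eqP: ji'; exact/val_inj/(disj _ _ l (ltn_ord j) i'S ls lj li').
have M_col i j l : (i < size S)%N -> j \in nth [::] S i -> R j l ->
    \sum_(1 <= j' < n.+1 | j' \in nth [::] S i) M j' l = M j l.
  move=> iS ji Rjl; rewrite big_mkcond (bigD1_seq j) ?iota_uniq //=; last first.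
    by rewrite mem_index_iota ltnS -iota_range (S_sub i).
  rewrite ji big1 ?addr0 // => j' j'j; case: ifP => // j'i.
  by apply: M0; apply: contra j'j => Rj'l; apply/eqP/(R_uniq i _ _ l).
have N0 i i' : (i < size S)%N -> (i' < size S)%N -> i != i' -> N i i' = 0.
  move=> iS i'S ii'; have [l li' [ls Rl]] := sep i i' iS i'S ii'.
  rewrite -(N_col i l i') // -MN //; last by rewrite -iota_range (S_sub i').
  by rewrite big1 // => j /Rl /M0.
have Nii i : (i < size S)%N -> N i i = M s s.
  move=> iS; rewrite -(M_col i) ?sS // MN //; last by rewrite -iota_range (S_sub i) ?sS.
  rewrite big_mkord (bigD1 (Ordinal iS)) ?sS //= big1 ?addr0 // => j /andP[_ ji].
  by rewrite N0 // eq_sym; apply: contraNneq ji => ij; apply/eqP/val_inj.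
exists (M s s) => j j_range l l_range.
have [Rjl|nRjl] := boolP (R j l); last first.
  by rewrite M0 //; case: eqP nRjl => // ->; rewrite R_refl.
have [i iS ji] : exists2 i, (i < size S)%N & j \in nth [::] S i.
  have [->|js] := eqVneq j s; first by exists 0%N; rewrite ?sS.
  by apply: cover => //; rewrite iota_range.
(* If l were s, or in the same subset as j, [R_uniq] against R l l would give j = l. So l lies in
   another subset and M j l is an off-diagonal entry of N. *)
have [jl|jl] := eqVneq j l; last first.
  have ls : l != s.
    by apply: contraNneq jl => ls; apply/eqP/(R_uniq i _ _ l); rewrite // ls sS.
  have [i' i'S li'] := cover l (etrans (iota_range l) l_range) ls.
  rewrite -(M_col i) // MN // (N_col i l i') // N0 //.
  apply: contraNneq jl => ii'; apply/eqP/(R_uniq i _ _ l) => //.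
  by rewrite ii'.
rewrite -{l}jl mulr1n in l_range Rjl *.
have [->//|js] := eqVneq j s.
by rewrite -(M_col i) // MN // (N_col i j i) ?Nii.
Qed.

Definition presentable (k : nzRingType) (b c : seq nat) (S : seq (seq nat)) :=
  [/\ all (all (fun l => (1 <= l <= sumn b)%N)) S, separated S,
      exists x y, overlap_in x y S & rigid k (compatible b c) (sumn b) S].

Lemma compatible_refl b c l : compatible b c l l.
Proof. by apply/andP; split; apply/allP => i _; apply: implybb. Qed.

Lemma compatible_left b c i j l : (i <= size b)%N -> compatible b c j l ->
  (j <= sumn (take i b) -> l <= sumn (take i b))%N.
Proof.
move=> ib /andP[/allP/(_ i)]; rewrite mem_iota add0n ltnS ib.
by move=> /(_ isT)/implyP.
Qed.

Lemma compatible_range b c j l : compatible b c j l ->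
  (1 <= j <= sumn b)%N -> (1 <= l <= sumn b)%N.
Proof.
move=> jl /andP[j_gt0 jb]; have := compatible_left (leqnn (size b)) jl.
rewrite take_size => /(_ jb)->; case/andP: jl => _ /allP/(_ (size c)).
rewrite mem_iota add0n ltnS leqnn take_size subnn.
by move=> /(_ isT)/implyP/(_ j_gt0)->.
Qed.

Lemma sumn_take_nseq1 i n : (i <= n)%N -> sumn (take i (nseq n 1%N)) = i.
Proof. by move=> le_in; rewrite take_nseq // sumn_nseq mul1n. Qed.

Lemma compatible_nseq1 b n j l : compatible b (nseq n 1%N) j l ->
  (1 <= j <= n)%N -> (j <= l)%N.
Proof.
(* The smallest member of C containing e_j is spanned by e_j, ..., e_n, of dimension n - j + 1. *)
move=> /andP[_ /allP/(_ (n - j).+1)] + jn; rewrite mem_iota size_nseq.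
move=> /(_ ltac:(lia))/implyP; rewrite sumn_take_nseq1; last lia.
by rewrite sumn_nseq mul1n; lia.
Qed.

(** For opposite complete flags C gives j <= l and B gives l <= j, so M is diagonal. *)
Lemma compatible_nseq11 n j l : compatible (nseq n 1%N) (nseq n 1%N) j l ->
  (1 <= j <= n)%N -> j = l.
Proof.
move=> jl jn; have := compatible_nseq1 jl jn.
have := compatible_left (i := j) _ jl.
rewrite size_nseq sumn_take_nseq1; lia.
Qed.

(** B forbids moving to a later block and C forbids moving to a smaller index, so j and l share a
    block; the boolean equalities express this in a form suited to [lia]. *)
Lemma compatible3 x y z n j l : compatible [:: x; y; z] (nseq n 1%N) j l ->
  (x + y + z)%N = n -> (1 <= j <= n)%N ->
  [/\ (j <= l <= n)%N, (j <= x)%N = (l <= x)%N & (j <= x + y)%N = (l <= x + y)%N].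
Proof.
move=> jl xyz jn; have jl' := compatible_nseq1 jl jn.
have := compatible_range jl; rewrite /=.
have := compatible_left (i := 1%N) (b := [:: x; y; z]) isT jl.
have := compatible_left (i := 2) (b := [:: x; y; z]) isT jl.
by rewrite /= ?take0 ?addn0 => h1 h2 h3; split; lia.
Qed.

(* The subset number i (counted from 0) is {s, al + i, be - i}, where al + i
   occurs only for i < u and be - i only for v <= i; the remaining hypotheses
   say that {s} and the two intervals so covered partition {1, ..., n} and are
   unions of blocks of B.  When 1 < v there is no decreasing interval to exploit,
   whence the last alternative. *)
Lemma star_family (k : nzRingType) (b c : seq nat) n s a u v al be S :
  sumn b = n -> size S = a ->
  (forall i l, (i < a)%N -> (l \in nth [::] S i) =
     [|| l == s, (l == al + i)%N && (i < u)%N | (l == be - i)%N && (v <= i)%N]) ->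
  [/\ 0 < a <= be, v <= u <= a & a <= u.+1]%N ->
  (forall l, (1 <= l <= n)%N ->
     [|| l == s, al <= l < al + u | be - a < l <= be - v]%N) ->
  (1 <= s <= n /\ 1 <= al)%N ->
  (al + u <= n.+1)%N ->
  (be - v <= n)%N ->
  (forall j l, (1 <= j <= n)%N -> compatible b c j l ->
     (j <= l)%N && [|| (j == s) && (l == s), (al <= j)%N && (l < al + u)%N |
                       (be - a < j)%N && (l <= be - v)%N]) ->
  [|| s < al | al + u <= s]%N ->
  [|| s <= be - a | be - v < s]%N ->
  [|| al + u <= (be - a).+1 | be - v < al]%N ->
  (v <= 1)%N \/ (forall j l, (1 <= j <= n)%N -> compatible b c j l -> j = l) ->
  presentable k b c S.
Proof.
move=> bn sizeS memS [a_be vua au] cover [s_range al1] aun bvn comp sI sJ IJ diag.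
have S_sub i l : (i < a)%N -> l \in nth [::] S i -> (1 <= l <= n)%N.
  by move=> ia; rewrite memS //; lia.
split.
- rewrite bn; apply/(all_nthP [::]) => i; rewrite sizeS => ia; apply/allP => l.
  exact: S_sub.
(* Subset i owns al + i if i < u, and otherwise be - i, present because v <= u <= i. *)
- move=> i; rewrite sizeS => ia; have [iu|ui] := ltnP i u.
    exists (al + i)%N => [|i' i'a]; rewrite memS //; lia.
  exists (be - i)%N => [|i' i'a]; rewrite memS //; lia.
- exists s, s => i j l; rewrite sizeS => ia ja ij; rewrite !memS // !inE; lia.
apply: (star_rigid (s := s)); rewrite ?sizeS ?bn; first lia.
- by move=> i ia l /(S_sub _ _ ia); rewrite mem_iota; lia.
- by move=> i ia; rewrite memS ?eqxx.
- move=> l; rewrite mem_iota => ln ls; have := cover l; move=> cov.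
  have [lI|lI] := boolP (al <= l < al + u)%N.
    by exists (l - al)%N; rewrite ?memS //; lia.
  by exists (be - l)%N; rewrite ?memS //; lia.
- by move=> i i' l ia i'a ls; rewrite !memS //; lia.
- exact: compatible_refl.
(* Both j and j' lie in the same piece as l, be it {s} or one of the intervals, and a subset meets
   each piece at most once. *)
- move=> i j j' l ia ji j'i.
  move=> /(comp _ _ (S_sub _ _ ia ji)) /andP[jl l_block].
  move=> /(comp _ _ (S_sub _ _ ia j'i)) /andP[j'l l_block'].
  move: ji j'i; rewrite !memS // {memS S_sub comp diag cover}.
  move: l_block l_block' => /or3P[] /andP[j1 j2] /or3P[] /andP[j1' j2'];
  move=> /or3P[/eqP Hj|/andP[/eqP Hj Hj0]|/andP[/eqP Hj Hj0]]
    /or3P[/eqP Hj'|/andP[/eqP Hj' Hj0']|/andP[/eqP Hj' Hj0']]; lia.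
(* Compatible moves never decrease the index. For i < i' and v <= 1 the target be - i' lies left of
   be - i; for i' < i the target al + i' lies left of al + i, and it occurs since i' < i <= u. *)
move=> i i' ia i'a ii'; have [lt_ii'|lt_i'i] : (i < i' \/ i' < i)%N by lia.
- case: diag => [v1|diag].
    exists (be - i')%N; first by rewrite memS //; lia.
    split; first by lia.
    move=> j ji; apply/negP => /(comp _ _ (S_sub _ _ ia ji)) /andP[jl l_block].
    by move: ji; rewrite memS //; case/or3P: l_block => /andP[]; lia.
  (* With M diagonal, any index owned by i' is out of reach from subset i. *)
  have [iu|ui] := ltnP i' u.
    exists (al + i')%N; first by rewrite memS //; lia.
    split; first by lia.
    move=> j ji; apply/negP => /(diag _ _ (S_sub _ _ ia ji)) jl.
    by move: ji; rewrite memS //; lia.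
  exists (be - i')%N; first by rewrite memS //; lia.
  split; first by lia.
  move=> j ji; apply/negP => /(diag _ _ (S_sub _ _ ia ji)) jl.
  by move: ji; rewrite memS //; lia.
exists (al + i')%N; first by rewrite memS //; lia.
split; first by lia.
move=> j ji; apply/negP => /(comp _ _ (S_sub _ _ ia ji)) /andP[jl l_block].
by move: ji; rewrite memS //; case/or3P: l_block => /andP[]; lia.
Qed.

(** * The infinite families *)

Lemma nth_map_index_iota (T : Type) (x0 : T) F i0 i1 i : (i < i1 - i0)%N ->
  nth x0 [seq F k | k <- index_iota i0 i1] i = F (i0 + i)%N.
Proof. by move=> lt_i; rewrite (nth_map 0%N) ?size_iota // nth_iota. Qed.

(** M is diagonal, and stability of the line through e_1 + ... + e_n equates all its diagonal
    entries with [N 0 0]. The case n = 1 covers ((1),(1),(1)). *)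
Lemma line_presentable (k : nzRingType) n : (0 < n)%N ->
  presentable k (nseq n 1%N) (nseq n 1%N) [:: index_iota 1 n.+1].
Proof.
move=> n_gt0; rewrite /presentable sumn_nseq mul1n; split.
- by rewrite /= andbT; apply/allP => l; rewrite mem_index_iota ltnS.
- by case=> //= _; exists 1%N => [|[]//]; rewrite mem_index_iota.
- by exists 0%N, 0%N => -[|i] [|j].
move=> M N M0 MN; exists (N 0 0)%N => j jn l _.
have [<-|jl] := eqVneq j l; last first.
  by rewrite M0 //; apply: contra jl => /compatible_nseq11 ->.
have <- : \sum_(0 <= i' < 1 | j \in nth [::] [:: index_iota 1 n.+1] i') N 0%N i'
        = N 0 0%N.
  by rewrite big_mkcond big_nat1 /= mem_index_iota ltnS jn.
rewrite -(MN 0%N j isT jn) [nth _ _ _]/= -big_seq.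
rewrite (bigD1_seq j) ?mem_index_iota ?iota_uniq //.
rewrite big1_seq /= ?addr0 // => i /andP[ij]; rewrite mem_index_iota ltnS => i_n.
by rewrite M0 //; apply: contra ij => /compatible_nseq11 ->.
Qed.

Lemma hyperplane_presentable (k : nzRingType) n : (2 <= n)%N ->
  presentable k (nseq n 1%N) (nseq n 1%N) 
    [seq [:: 1; k + 1] | k <- index_iota 1 n]%N.
Proof.
move=> n_ge2.
(* Taking v = a removes every be - i, leaving the subsets {1, 2 + i}. *)
apply: (@star_family _ _ _ n 1 n.-1 n.-1 n.-1 2 n.-1) => /=; try lia.
- by rewrite sumn_nseq mul1n.
- by rewrite size_map size_iota; lia.
- by move=> i l ia; rewrite nth_map_index_iota ?inE; lia.
- by split; lia.
- by move=> j l jn /compatible_nseq11 /(_ jn) <-; lia.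
- by right=> j l jn /compatible_nseq11 ->.
Qed.

(** The alternatives put the block {s} first, in the middle or last. Of the other two blocks, the
    earlier, of size u, carries the indices al + i and the later, of size a - v, the indices be -
    i. *)
Lemma star3_presentable (k : nzRingType) n x y z s a u v al be S :
  (x + y + z)%N = n -> size S = a ->
  (forall i l, (i < a)%N -> (l \in nth [::] S i) =
     [|| l == s, (l == al + i)%N && (i < u)%N | (l == be - i)%N && (v <= i)%N]) ->
  [/\ 0 < a <= be, v <= u <= a, a <= u.+1 & v <= 1]%N ->
  [\/ [/\ x = 1, y = u & z = a - v] /\ [/\ s = 1, al = 2 & be = n + v],
      [/\ y = 1, x = u & z = a - v] /\ [/\ s = x.+1, al = 1 & be = n + v] |
      [/\ z = 1, x = u & y = a - v] /\ [/\ s = n, al = 1 & be = n - 1 + v]]%N ->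
  presentable k [:: x; y; z] (nseq n 1%N) S.
Proof.
move=> <-{n} sizeS memS [r1 r2 r3 r4] blocks.
apply: (@star_family _ _ _ (x + y + z) s a u v al be) => //=; try by left.
all: try move=> j l jn /compatible3/(_ erefl jn) [jl jx jxy].
all: by case: blocks => [][[? ? ?] [? ? ?]]; try split; lia.
Qed.

(** * The sporadic cases of dimension 6, then all listed cases *)

Lemma range6 (P : nat -> Prop) :
  P 1%N -> P 2%N -> P 3%N -> P 4%N -> P 5%N -> P 6%N ->
  forall j, (1 <= j <= 6)%N -> P j.
Proof. by move=> ? ? ? ? ? ?; do 7![case=> //]. Qed.

Ltac row_equations MN i :=
  generalize (MN i 1%N isT isT) (MN i 2%N isT isT) (MN i 3%N isT isT)
    (MN i 4%N isT isT) (MN i 5%N isT isT) (MN i 6%N isT isT).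

(* Propagating the zero entries through the equations leaves only equalities
   between single entries. *)
Ltac rigid6 :=
  let M := fresh "M" in let N := fresh "N" in
  let M0 := fresh "M0" in let MN := fresh "MN" in
  move=> M N M0 MN;
  (* There are two to four subsets; [try] skips the missing rows. *)
  try row_equations MN 3%N; try row_equations MN 2%N;
  row_equations MN 1%N; row_equations MN 0%N; clear MN;
  rewrite unlock /=;
  repeat match goal with |- context[M ?j ?l] => rewrite (M0 j l isT) end;
  rewrite ?addr0 ?add0r; intros;
  repeat match goal with
  | H : 0 = ?f _ _ |- _ => is_var f; apply esym in H
  | H : ?f ?i ?j = 0, H' : context[?f ?i ?j] |- _ =>
      is_var f; assert_fails (constr_eq H H'); rewrite H ?addr0 ?add0r in H'
  end;
  exists (M 1%N 1%N); apply: range6; apply: range6;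
  rewrite ?mulr0n ?mulr1n; first [exact: M0 | assumption | congruence].


Ltac overlap6 x y :=
  exists x, y => -[|[|[|[|?]]]] [|[|[|[|?]]]] ? //= _ _ ?; rewrite !inE; lia.

Ltac separated6 :=
  move=> -[|[|[|[|?]]]] //= _;
  first [ by exists 1%N => // -[|[|[|[|?]]]] | by exists 2%N => // -[|[|[|[|?]]]]
        | by exists 3%N => // -[|[|[|[|?]]]] | by exists 4%N => // -[|[|[|[|?]]]]
        | by exists 5%N => // -[|[|[|[|?]]]] | by exists 6%N => // -[|[|[|[|?]]]] ].

Lemma nth_cat_singleton (T : Type) (x0 : T) (s : seq T) y i : (i <= size s)%N ->
  nth x0 (s ++ [:: y]) i = if (i < size s)%N then nth x0 s i else y.
Proof.
rewrite nth_cat leq_eqVlt; case: ltnP => // _ /orP[/eqP->|//].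
by rewrite subnn.
Qed.

Ltac star3 s a u v al be :=
  apply: (@star3_presentable _ _ _ _ _ s a u v al be);
  [ lia
  | by rewrite /= ?size_cat ?size_map ?size_iota /=; lia
  |
  | split; lia
  | first [constructor 1; split; split; lia | constructor 2; split; split; lia
          | constructor 3; split; split; lia] ].

Lemma listed_presentable (k : nzRingType) a b c S :
  listed a b c S -> presentable k b c S.
Proof.
case=> [||||||||m m2|m m2|m m2|m m2|m m2|m m2
       |m m2|m m2|m m2|m m2|m m2|m m2|n n2|n n2].
- exact: (line_presentable k (n := 1)).
- by split; [|separated6|overlap6 2%N 5%N|rigid6].
- by split; [|separated6|overlap6 1%N 2%N|rigid6].
- by split; [|separated6|overlap6 5%N 6%N|rigid6].
- by split; [|separated6|overlap6 4%N 2%N|rigid6].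
- by split; [|separated6|overlap6 1%N 1%N|rigid6].
- by split; [|separated6|overlap6 1%N 1%N|rigid6].
- by split; [|separated6|overlap6 1%N 1%N|rigid6].
(* In what follows v = 1 when the first subset lacks its decreasing index, and u = a - 1 when the
   last one lacks its increasing index. *)
- star3 1%N m m 0%N 2%N (2 * m + 1)%N.
  by move=> i l im; rewrite nth_map_index_iota ?inE; lia.
- star3 1%N m.+1 m 1%N 2%N (2 * m + 2)%N.
  case=> [|i] l im /=; rewrite ?nth_cat_singleton ?size_map ?size_iota ?inE;
    [lia | | lia].
  by case: ltnP => im'; rewrite ?nth_map_index_iota ?inE; lia.
- star3 m.+1 m m 0%N 1%N (2 * m + 1)%N.
  by move=> i l im; rewrite nth_map_index_iota ?inE; lia.
- star3 m.+1 m.+1 m 1%N 1%N (2 * m + 2)%N.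
  case=> [|i] l im /=; rewrite ?nth_cat_singleton ?size_map ?size_iota ?inE;
    [lia | | lia].
  by case: ltnP => im'; rewrite ?nth_map_index_iota ?inE; lia.
- star3 (2 * m + 1)%N m m 0%N 1%N (2 * m)%N.
  by move=> i l im; rewrite nth_map_index_iota ?inE; lia.
- star3 (2 * m + 1)%N m.+1 m 1%N 1%N (2 * m + 1)%N.
  case=> [|i] l im /=; rewrite ?nth_cat_singleton ?size_map ?size_iota ?inE;
    [lia | | lia].
  by case: ltnP => im'; rewrite ?nth_map_index_iota ?inE; lia.
- star3 1%N m m.-1 0%N 2%N (2 * m)%N.
  move=> i l im; rewrite nth_cat_singleton size_map size_iota; last lia.
  by case: ltnP => im'; rewrite ?nth_map_index_iota ?inE; lia.
- star3 1%N m m 1%N 2%N (2 * m + 1)%N.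
  by case=> [|i] l im /=; rewrite ?nth_map_index_iota ?inE; lia.
- star3 m m m.-1 0%N 1%N (2 * m)%N.
  move=> i l im; rewrite nth_cat_singleton size_map size_iota; last lia.
  by case: ltnP => im'; rewrite ?nth_map_index_iota ?inE; lia.
- star3 m.+1 m m 1%N 1%N (2 * m + 1)%N.
  by case=> [|i] l im /=; rewrite ?nth_map_index_iota ?inE; lia.
- star3 (2 * m)%N m m.-1 0%N 1%N (2 * m - 1)%N.
  move=> i l im; rewrite nth_cat_singleton size_map size_iota; last lia.
  by case: ltnP => im'; rewrite ?nth_map_index_iota ?inE; lia.
- star3 (2 * m)%N m m 1%N 1%N (2 * m)%N.
  by case=> [|i] l im /=; rewrite ?nth_map_index_iota ?inE; lia.
- exact: hyperplane_presentable.
- by apply: line_presentable; lia.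
Qed.

Lemma listed_dims a b c S : listed a b c S ->
  [/\ (0 < size a <= 2)%N, (0 < sumn a)%N, sumn b = sumn a, sumn c = sumn a &
      size S = nth 0%N a 0].
Proof.
by case=> *; split=> //=;
  rewrite ?sumn_nseq ?size_cat ?size_map ?size_iota /=; lia.
Qed.

(** * Every permutation of a base triple is listed *)

Lemma perm_consP_cat (T : eqType) (x : T) s t : perm_eq t (x :: s) ->
  exists t1 t2, t = t1 ++ x :: t2 /\ perm_eq (t1 ++ t2) s.
Proof.
move=> t_xs; have x_t : x \in t by rewrite (perm_mem t_xs) mem_head.
case: (splitPr x_t) t_xs => t1 t2 t_xs.
by exists t1, t2; rewrite -(perm_cons x) (perm_catCA [:: x] t1 t2).
Qed.

Lemma perm_nseq (T : eqType) (x : T) n t : perm_eq t (nseq n x) -> t = nseq n x.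
Proof.
move=> t_x; rewrite -(size_nseq n x) -(perm_size t_x); apply/all_pred1P/allP => y.
by rewrite (perm_mem t_x) mem_nseq => /andP[].
Qed.

Lemma perm_seq2 (T : eqType) (x y : T) t : perm_eq t [:: x; y] ->
  t = [:: x; y] \/ t = [:: y; x].
Proof.
case/perm_consP_cat => [[|u [|w t1]]] [t2] [-> /(@perm_nseq _ y 1)] //=.
  by move=> ->; left.
by case=> -> ->; right.
Qed.

Lemma perm_seq3 (T : eqType) (x y z : T) t : perm_eq t [:: x; y; z] ->
  t \in [:: [:: x; y; z]; [:: x; z; y]; [:: y; x; z];
            [:: z; x; y]; [:: y; z; x]; [:: z; y; x]].
Proof.
case/perm_consP_cat => [[|u [|w [|w' t1]]]] [t2] [-> /perm_seq2[] //=]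
    => [->|->|[-> ->]|[-> ->]|[-> -> ->]|[-> -> ->]];
  by rewrite !inE eqxx ?orbT.
Qed.

Lemma permuted_listed a b c : permuted_base_triple a b c ->
  exists S, listed a b c S.
Proof.
case=> a0 [b0 [c0 [base [a_perm b_perm c_perm]]]].
case: base a_perm b_perm c_perm => [|||m m2|m m2|n n2].
- move=> /(@perm_nseq _ _ 1)-> /(@perm_nseq _ _ 1)-> /(@perm_nseq _ _ 1)->.
  by eexists; constructor.
- move=> /(@perm_nseq _ _ 2)-> /perm_nseq->.
  move=> /perm_consP_cat[t1 [t2 [-> /(@perm_nseq _ _ 4)]]].
  (* The number of ones before the part 2, which is the length of t1, selects one of five listed
     cases. *)
  by case: t1 => [|? [|? [|? [|? [|? ?]]]]] //= [] *; subst; eexists; constructor.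
- by move=> /perm_seq2[]-> /perm_nseq-> /perm_nseq->; eexists; constructor.
(* Equal parts make some of the six orderings coincide; each is matched with a listed case
   separately. *)
- move=> /perm_seq2[]-> /perm_seq3 + /perm_nseq->; rewrite !inE;
  by repeat case/orP; move=> /eqP->; eexists; constructor.
- move=> /(@perm_nseq _ _ 2)-> /perm_seq3 + /perm_nseq->; rewrite !inE;
  by repeat case/orP; move=> /eqP->; eexists; constructor.
by move=> /perm_seq2[]-> /perm_nseq-> /perm_nseq->; eexists; constructor.
Qed.

Theorem theorem2p9 (k : closedFieldType) (p q r : nat)
    (a : p.-tuple nat) (b : q.-tuple nat) (c : r.-tuple nat)
    (hPi : in_Pi k a b c) (hperm : permuted_base_triple a b c) :
  (exists S : seq (seq nat), listed a b c S) /\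
  (forall S : seq (seq nat), listed a b c S ->
     (exists X : triple_flag k p q r,
        [/\ indecomposable X, has_dim_vector X a b c &
            presented_in_standard_form X S]) /\
     (forall X : triple_flag k p q r,
        represents_I a b c X -> presented_in_standard_form X S)).
Proof.
split=> [|S S_listed]; first exact: permuted_listed.
have [size_a a_gt0 sum_b sum_c sizeS] := listed_dims S_listed.
rewrite size_tuple in size_a.
have [rangeS sepS [x [y overS]] rigS] := listed_presentable k S_listed.
rewrite sum_b in rangeS rigS.
have X_exists :=
  standard_object size_a a_gt0 sum_b sum_c sizeS rangeS sepS overS rigS.
split=> // X [_ dimX X_unique]; have [Y [Y_ind dimY Y_std]] := X_exists.
exact: presented_iso (X_unique Y Y_ind dimY) dimX dimY Y_std.
Qed.
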